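(* Let $\xi\prec\eta$ for some $\xi,\eta\in \mathrm{c}_{\mathrm{o}}^*$ with $\xi_n>0$ for every $n$, and let $\{m_k,t_k\}$ and $Q(\xi,\eta)$ be the sequence and the matrix canonically associated with the pair $(\xi,\eta)$ (see context). Then the following conditions are equivalent. (i) $\xi\preccurlyeq\eta$. (ii) $\sum\{t_k\mid m_k=1\}=\infty$. (iii) $Q(\xi,\eta)$ is orthostochastic.
   Context: $\mathrm{c}_{\mathrm{o}}^*$ denotes the cone of nonnegative monotone nonincreasing sequences converging to $0$ (not a dual space). For $\xi,\eta\in \mathrm{c}_{\mathrm{o}}^*$: $\xi\prec\eta$ means $\sum_{j=1}^n\xi_j\le\sum_{j=1}^n\eta_j$ for every $n\in\mathbb N$; $\xi\preccurlyeq\eta$ (strong majorization) means $\xi\prec\eta$ and $\liminf_n\sum_{j=1}^n(\eta_j-\xi_j)=0$. Infinite matrices are identified with operators on $\ell^2$ via the standard orthonormal basis. An orthogonal matrix is a unitary matrix with real entries. A matrix $Q$ is orthostochastic if $Q_{ij}=(U_{ij})^2$ for all $i,j$, for some orthogonal matrix $U$. The sum in (ii) is the sum of $t_k$ over all indices $k$ with $m_k=1$. Construction of $\{m_k,t_k\}$ and $Q(\xi,\eta)$ (for $\xi,\eta\in \mathrm{c}_{\mathrm{o}}^*$, $\xi\prec\eta$, all $\xi_n>0$). Set $\rho(0):=\eta$. For $k\ge 1$, given the nonincreasing sequence $\rho(k-1)$, let $m_k\in\mathbb N$ be the unique positive integer with $\rho(k-1)_{m_k+1}<\xi_k\le\rho(k-1)_{m_k}$,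 let $t_k\in(0,1]$ be the unique number with $\xi_k=t_k\rho(k-1)_{m_k}+(1-t_k)\rho(k-1)_{m_k+1}$, let $\delta_k:=(1-t_k)\rho(k-1)_{m_k}+t_k\rho(k-1)_{m_k+1}$, and define $\rho(k)$ by $\rho(k)_j=\rho(k-1)_j$ for $j<m_k$, $\rho(k)_{m_k}=\delta_k$, and $\rho(k)_j=\rho(k-1)_{j+1}$ for $j>m_k$. (The process can be carried on for all $k$.) For $m\ge1$ and $0<t\le1$ let $V(m,t)$ be the $(m+1)\times(m+1)$ real orthogonal matrix whose entries are $V_{1,m}=\sqrt t$, $V_{1,m+1}=-\sqrt{1-t}$, $V_{i,i-1}=1$ for $2\le i\le m$, $V_{m+1,m}=\sqrt{1-t}$, $V_{m+1,m+1}=\sqrt t$, all other entries being $0$. With $I_n$ the $n\times n$ identity ($1\le n\le\infty$; $I_0$ is dropped), let $$W^{(n)}:=(I_{n-1}\oplus V(m_n,t_n)\oplus I_\infty)(I_{n-2}\oplus V(m_{n-1},t_{n-1})\oplus I_\infty)\cdots(I_1\oplus V(m_2,t_2)\oplus I_\infty)(V(m_1,t_1)\oplus I_\infty).$$ The first $n$ rows of $W^{(j)}$ are the same for all $j\ge n$, and $W(\xi,\eta)$ is the infinite matrix whose first $n$ rows are those of $W^{(n)}$, for every $n$; it is a co-isometry with real entries. $Q(\xi,\eta)$ is its Schur-square: $Q(\xi,\eta)_{ij}=(W(\xi,\eta)_{ij})^2$. *)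

(* Defs.v *)
From HB Require Import structures.
From mathcomp Require Import all_boot all_order all_algebra.
From mathcomp Require Import all_classical all_reals all_analysis.
Import Order.TTheory GRing.Theory Num.Theory.
Import numFieldNormedType.Exports.

Set Implicit Arguments.
Unset Strict Implicit.
Unset Printing Implicit Defensive.

Local Open Scope classical_set_scope.
Local Open Scope ring_scope.

(* Sequences, the steps of the construction, and the rows and columns of
   infinite matrices are indexed from 0: xi k stands for \xi_{k+1}.  The
   values of m are not shifted, so m k is the positive integer m_{k+1}, and
   \rho_m, \rho_{m+1} are written r m.-1, r m. *)

Definition co_star (R : realType) (xi : nat -> R) : Prop :=
  [/\ forall n, 0 <= xi n,
      forall n p, (n <= p)%N -> xi p <= xi n
    & xi @ \oo --> (0 : R)].

Definition majorized (R : realType) (xi eta : nat -> R) : Prop :=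
  forall n, \sum_(j < n) xi j <= \sum_(j < n) eta j.

(* The limit inferior is taken in \bar R, as the partial sums may be
   unbounded. *)
Definition strongly_majorized (R : realType) (xi eta : nat -> R) : Prop :=
  majorized xi eta /\
  limn_einf (fun n => (\sum_(j < n) (eta j - xi j))%:E) = 0%E.

(* The default value 1 of xget is only taken when there is no such number. *)
Definition step_index (R : realType) (r : nat -> R) (x : R) : nat :=
  xget 1%N [set m : nat | (0 < m)%N /\ r m < x <= r m.-1].

Definition step_coef (R : realType) (r : nat -> R) (x : R) : R :=
  let m := step_index r x in
  xget 1 [set t : R | 0 < t <= 1 /\ x = t * r m.-1 + (1 - t) * r m].

Definition step_seq (R : realType) (r : nat -> R) (x : R) : nat -> R :=
  let m := step_index r x in
  let t := step_coef r x in
  fun j => if (j < m.-1)%N then r j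
           else if j == m.-1 then (1 - t) * r m.-1 + t * r m
           else r j.+1.

Fixpoint rho (R : realType) (xi eta : nat -> R) (k : nat) : nat -> R :=
  if k is k'.+1 then step_seq (rho xi eta k') (xi k') else eta.

Definition mseq (R : realType) (xi eta : nat -> R) (k : nat) : nat :=
  step_index (rho xi eta k) (xi k).

Definition tseq (R : realType) (xi eta : nat -> R) (k : nat) : R :=
  step_coef (rho xi eta k) (xi k).

Definition Vmx (R : realType) (m : nat) (t : R) : 'M[R]_m.+1 :=
  \matrix_(i < m.+1, j < m.+1)
    if (i : nat) == 0%N then
      if (j : nat) == m.-1 then Num.sqrt t
      else if (j : nat) == m then - Num.sqrt (1 - t) else 0
    else if (i : nat) == m then
      if (j : nat) == m.-1 then Num.sqrt (1 - t)
      else if (j : nat) == m then Num.sqrt t else 0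
    else ((j : nat) == i.-1)%:R.

Definition infmx (R : realType) := nat -> nat -> R.

Definition infmx1 (R : realType) : infmx R := fun i j => (i == j)%:R.

Definition infmx_tr (R : realType) (A : infmx R) : infmx R := fun i j => A j i.

Definition infmx_mul (R : realType) (A B : infmx R) : infmx R :=
  fun i j => limn (series (fun k => A i k * B k j)).

(* I_n (+) A (+) I_oo *)
Definition infmx_embed (R : realType) (n m : nat) (A : 'M[R]_m.+1) : infmx R :=
  fun i j => if (n <= i <= n + m)%N && (n <= j <= n + m)%N
             then A (inord (i - n)) (inord (j - n)) else (i == j)%:R.

(* W^{(n)}, with the empty product W^{(0)} = I *)
Fixpoint Wfin (R : realType) (xi eta : nat -> R) (n : nat) : infmx R :=
  if n is n'.+1 then
    infmx_mul (infmx_embed n' (Vmx (mseq xi eta n') (tseq xi eta n')))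
              (Wfin xi eta n')
  else infmx1 R.

(* The row of index i is among the first i.+1 rows. *)
Definition Wmx (R : realType) (xi eta : nat -> R) : infmx R :=
  fun i j => Wfin xi eta i.+1 i j.

Definition Qmx (R : realType) (xi eta : nat -> R) : infmx R :=
  fun i j => Wmx xi eta i j ^+ 2.

(* A B = C, the series defining the entries of A B being convergent *)
Definition infmx_mul_eq (R : realType) (A B C : infmx R) : Prop :=
  forall i j, series (fun k => A i k * B k j) @ \oo --> C i j.

(* U U^* = U^* U = I for a real U.  Either equation makes U or its transpose
   an isometry of l^2, so no separate boundedness condition is needed. *)
Definition orthogonal_infmx (R : realType) (U : infmx R) : Prop :=
  infmx_mul_eq U (infmx_tr U) (infmx1 R) /\
  infmx_mul_eq (infmx_tr U) U (infmx1 R).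

Definition orthostochastic (R : realType) (Q : infmx R) : Prop :=
  exists U : infmx R, orthogonal_infmx U /\ forall i j, Q i j = U i j ^+ 2.

(* Main.v *)
Require Import Defs.
From HB Require Import structures.
From mathcomp Require Import all_boot all_order all_algebra.
From mathcomp Require Import zify lra ring.
From mathcomp Require Import all_classical all_reals all_analysis.
Import Order.TTheory GRing.Theory Num.Theory.
Import numFieldNormedType.Exports.

Set Implicit Arguments.
Unset Strict Implicit.
Unset Printing Implicit Defensive.

Local Open Scope classical_set_scope.
Local Open Scope ring_scope.

(* Let u_k be t_k if m_k = 1, and 0 otherwise.  The first entry of \rho(k) only
   changes when m_k = 1, and then it decreases by a part u_k of its difference
   with the second entry, which is below \xi_k -> 0.  Hence \rho(k)_1 -> 0 iff
   \sum u_k = oo.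
   Strong majorization is equivalent to \rho(k)_1 -> 0: the sum of the first n
   terms of \rho(k)_j - \xi_{k+j} is at most the sum of the first n + k terms of
   \eta_j - \xi_j, and for n = 1 they agree right after a step with m = 1,
   because k + m_k is nondecreasing.
   As for W, the rows of W^{(n)} below the n-th have pairwise disjoint supports,
   so each column j has a single nonzero entry there; its square c_n is what the
   first n entries of the column lack to have norm 1.  This entry gets one row
   closer to row n + 1 at each step with m = 1, and once it is there, c_n is
   multiplied by 1 - u at each step.  So all columns of W have norm 1 iff
   \sum u_k = oo, and then W itself is orthogonal, by the Gram identity for the
   columns of W^{(n)}. *)

(** * A single step of the construction *)

Lemma step_indexP (R : realType) (r : nat -> R) (x : R) :
    (exists m, r m < x) -> x <= r 0%N ->
  (0 < step_index r x)%N /\ r (step_index r x) < x <= r (step_index r x).-1.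
Proof.
move=> exm x_le.
have H : exists m : nat, [set m : nat | (0 < m)%N /\ r m < x <= r m.-1] m.
  (* The least [k] with [r k < x] qualifies: it is positive since [x <= r 0], and its predecessor
     fails the inequality. *)
  case: (@ex_minnP (fun k => r k < x) exm) => -[|m] /= rm min_m.
    by move: x_le; rewrite leNgt rm.
  exists m.+1; split=> //=; rewrite rm /= leNgt; apply/negP => /min_m.
  by rewrite ltnn.
exact: (xgetPex 1%N H).
Qed.

Lemma step_coefP (R : realType) (r : nat -> R) (x : R)
    (m := step_index r x) (t := step_coef r x) :
  r m < x <= r m.-1 -> 0 < t <= 1 /\ x = t * r m.-1 + (1 - t) * r m.
Proof.
move=> /andP[rx xr].
have d_gt0 : 0 < r m.-1 - r m by rewrite subr_gt0 (lt_le_trans rx).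
have H : exists s : R,
    [set s : R | 0 < s <= 1 /\ x = s * r m.-1 + (1 - s) * r m] s.
  exists ((x - r m) / (r m.-1 - r m)) => /=; split.
    apply/andP; split; first by rewrite divr_gt0// subr_gt0.
    by rewrite ler_pdivrMr// mul1r lerD2r.
  by field; rewrite gt_eqF.
exact: (xgetPex 1 H).
Qed.

(** Nonnegativity for all [n] says that [y] is majorized by [r]. *)
Definition partial_gap (R : realType) (r y : nat -> R) (n : nat) : R :=
  \sum_(j < n) (r j - y j).

(* The state of the construction before a step: r is what is left of \eta, and
   y what is left of \xi. *)
Definition dominates (R : realType) (r y : nat -> R) : Prop :=
  [/\ forall n, 0 <= r n, {homo r : n p / (n <= p)%N >-> p <= n},
      forall e, 0 < e -> exists n, r n < e & forall n, 0 <= partial_gap r y n].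

Section Step.
Context (R : realType) (r y : nat -> R).
Hypothesis y_gt0 : forall n, 0 < y n.
Hypothesis dom_ry : dominates r y.
Let m := step_index r (y 0%N).
Let t := step_coef r (y 0%N).
Let r' := step_seq r (y 0%N).
Let y' n := y n.+1.

Lemma dominates_step_index : (0 < m)%N /\ r m < y 0%N <= r m.-1.
Proof.
have [_ _ small gap] := dom_ry.
apply: step_indexP; first exact: small.
by have := gap 1%N; rewrite /partial_gap big_ord1 subr_ge0.
Qed.

Lemma dominates_step_coef : 0 < t <= 1 /\ y 0%N = t * r m.-1 + (1 - t) * r m.
Proof. exact: step_coefP dominates_step_index.2. Qed.

Lemma step_seq_lt j : (j < m.-1)%N -> r' j = r j.
Proof. by rewrite /r' /step_seq -/m => ->. Qed.

Lemma step_seq_eq : r' m.-1 = (1 - t) * r m.-1 + t * r m.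
Proof. by rewrite /r' /step_seq -/m -/t ltnn eqxx. Qed.

Lemma step_seq_ge j : (m <= j)%N -> r' j = r j.+1.
Proof.
move=> mj; have [m_gt0 _] := dominates_step_index.
rewrite /r' /step_seq -/m ltnNge ifF; last by apply/negbTE; lia.
by rewrite ifF //; apply/negbTE; lia.
Qed.

(** The step replaces [r m.-1] and [r m] by their sum minus [y 0]; once the place [m.-1] is counted,
    the sums of both sequences have lost exactly [y 0]. *)
Lemma partial_gap_step n : (m <= n)%N ->
  partial_gap r' y' n = partial_gap r y n.+1.
Proof.
have [m_gt0 _] := dominates_step_index.
have [_ y0E] := dominates_step_coef.
have gapE k : partial_gap r' y' k = \sum_(j < k) r' j + y 0%N -
    \sum_(j < k.+1) y j.
  rewrite /partial_gap big_split/= sumrN big_ord_recl/=; ring.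
rewrite gapE {gapE} /partial_gap [RHS]big_split/= sumrN => mn; congr (_ - _).
rewrite -(subnK mn); elim: (n - m)%N => [|d IH].
  rewrite add0n -(prednK m_gt0) !big_ord_recr/= step_seq_eq prednK//.
  rewrite (eq_bigr (fun j : 'I_m.-1 => r j)); last first.
    by move=> j _; rewrite step_seq_lt.
  by rewrite y0E; ring.
rewrite addSn big_ord_recr [RHS]big_ord_recr/= -IH step_seq_ge ?leq_addl//.
by ring.
Qed.

Lemma partial_gap_step_lt n : (n < m)%N ->
  \sum_(j < n) r' j = \sum_(j < n) r j.
Proof.
move=> nm; apply: eq_bigr => j _; rewrite step_seq_lt//.
by have := ltn_ord j; lia.
Qed.

(** For [n < m] the leading terms are unchanged and the right side exceeds the left by [r n - y 0],
    where [r n >= r m.-1 >= y 0]. *)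
Lemma partial_gap_step_le n : partial_gap r' y' n <= partial_gap r y n.+1.
Proof.
have [/partial_gap_step ->//|nm] := leqP m n.
rewrite /partial_gap [in leRHS]big_split/= big_split/= !sumrN.
rewrite partial_gap_step_lt// big_ord_recr [in leRHS]big_ord_recl/=.
rewrite -addrA lerD2l opprD addrA lerDr subr_ge0.
have [_ nonincr _ _] := dom_ry.
have [m_gt0 /andP[_ y0le]] := dominates_step_index.
by rewrite (le_trans y0le)// nonincr//; lia.
Qed.

Lemma dominates_step : {homo y : n p / (n <= p)%N >-> p <= n} ->
  dominates r' y'.
Proof.
move=> y_mono; have [r_ge0 r_mono small gap] := dom_ry.
have [m_gt0 /andP[y0gt y0le]] := dominates_step_index.
have [/andP[t_gt0 t_le1] y0E] := dominates_step_coef.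
have r_m : r m <= r' m.-1 <= r m.-1.
  rewrite step_seq_eq; have : r m <= r m.-1 by apply: r_mono; lia.
  by move=> rr; apply/andP; split; nra.
(* This interlacing yields the sign, the monotonicity and the smallness of [r']. *)
have r'_le n : r n.+1 <= r' n <= r n.
  have [nm|nm|->] := ltngtP n m.-1.
  - by rewrite step_seq_lt// lexx r_mono.
  - by rewrite step_seq_ge ?lexx ?r_mono//; lia.
  - by rewrite (prednK m_gt0).
split.
- by move=> n; case/andP: (r'_le n) => + _; apply: le_trans.
- suff r'S n : r' n.+1 <= r' n.
    move=> n p np; rewrite -(subnK np); elim: (p - n)%N => // d IH.
    by rewrite addSn (le_trans (r'S _)).
  have /andP[_ h1] := r'_le n.+1; have /andP[h2 _] := r'_le n.
  exact: le_trans h2.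
- move=> e /small[n ren]; exists n.
  by case/andP: (r'_le n) => _ h; apply: le_lt_trans ren.
(* Before [m] the gap is a sum of nonnegative terms: [r j >= r m.-1 >= y 0 >= y j.+1]. *)
- move=> n; have [/partial_gap_step ->//|nm] := leqP m n.
  rewrite /partial_gap big_split/= partial_gap_step_lt// -big_split/=.
  apply: sumr_ge0 => j _; rewrite subr_ge0 (le_trans (y_mono 0%N j.+1 _))//.
  by rewrite (le_trans y0le)// r_mono//; have := ltn_ord j; lia.
Qed.

End Step.

(** * Series, limits inferior, and decay or persistence of real sequences *)

Lemma nneseries_pinftyP (R : realType) (P : pred nat) (t : nat -> R) :
    (forall k, P k -> 0 <= t k) ->
  (\sum_(0 <= k <oo | P k) (t k)%:E = +oo)%E <->
  (forall M, exists n, M < \sum_(k < n) (if P k then t k else 0)).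
Proof.
move=> t_ge0.
have tE_ge0 n : (0 <= n)%N -> P n -> (0 <= (t n)%:E)%E.
  by move=> _ /t_ge0; rewrite lee_fin.
have sumE n : (\sum_(0 <= k < n | P k) (t k)%:E)%E =
    (\sum_(k < n) (if P k then t k else 0))%:E.
  by rewrite sumEFin big_mkcond/= big_mkord.
split=> [sumy M|unb].
  apply: contrapT => /forallNP bd; suff : (+oo <= M%:E)%E by [].
  rewrite -sumy; apply: lime_le; first exact: is_cvg_nneseries_cond.
  by apply: nearW => n; rewrite sumE lee_fin leNgt; apply/negP/bd.
apply/eqyP => A _; have [n An] := unb A.
apply: le_trans (nneseries_lim_ge n tE_ge0).
by rewrite sumE lee_fin ltW.
Qed.

(** The limit inferior is the supremum of the tail infima [einfs]; these are nonnegative here, so it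
    vanishes iff all of them do. *)
Lemma limn_einf0P (R : realType) (u : nat -> R) : (forall n, 0 <= u n) ->
  limn_einf (fun n => (u n)%:E) = 0%E <->
  (forall e, 0 < e -> forall N, exists2 n, (N <= n)%N & u n < e).
Proof.
move=> u_ge0; set v := fun n => (u n)%:E; rewrite limn_einf_lim.
have -> := cvg_lim (@ereal_hausdorff R) (@cvg_einfs_sup _ v).
split=> [sup0 e e_gt0 N|small].
  have : (einfs v N < e%:E)%E.
    apply: (@le_lt_trans _ _ 0%E); last by rewrite lte_fin.
    by rewrite -sup0; apply: ereal_sup_ubound; exists N.
  by move=> /ereal_inf_lt[_ [n /= Nn <-]]; rewrite lte_fin; exists n.
apply/eqP; rewrite eq_le; apply/andP; split.
  apply: ge_ereal_sup => _ [N _ <-].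
  apply/lee_addgt0Pr => e /small/(_ N)[n Nn ue]; rewrite add0e.
  apply: ge_ereal_inf; exists (u n)%:E; last by rewrite lee_fin ltW.
  by exists n.
apply: (@le_trans _ _ (einfs v 0%N)); last first.
  by apply: ereal_sup_ubound; exists 0%N.
by apply: le_ereal_inf_tmp => _ [n _ <-]; rewrite lee_fin.
Qed.

(** If [a] stayed above some [L > 0], its total decrease past [K], at most [a K], would bound the
    tail sums of [c * u]. *)
Lemma decay_to0 (R : realType) (a u : nat -> R) :
    (forall n, 0 <= a n) -> (forall n, a n.+1 <= a n) -> (forall n, 0 <= u n) ->
    (forall M, exists n, M < \sum_(k < n) u k) ->
    (forall L, 0 < L -> (forall n, L <= a n) -> exists2 c, 0 < c &
      exists K, forall n, (K <= n)%N -> c * u n <= a n - a n.+1) ->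
  forall e, 0 < e -> exists n, a n < e.
Proof.
move=> a_ge0 a_noninc u_ge0 unb decr e e_gt0; apply: contrapT => /forallNP bd.
have [|c c_gt0 [K dK]] := decr e e_gt0.
  by move=> n; rewrite leNgt; apply/negP/bd.
have sumK d : c * \sum_(k < d + K) u k <=
    c * \sum_(k < K) u k + a K - a (d + K)%N.
  elim: d => [|d IH]; first by rewrite add0n addrK.
  rewrite addSn big_ord_recr/= mulrDr.
  by have := dK (d + K)%N (leq_addl _ _); lra.
have [n] := unb (\sum_(k < K) u k + a K / c).
rewrite ltNge => /negP; apply.
apply: (@le_trans _ _ (\sum_(k < n + K) u k)).
  by rewrite big_split_ord/= lerDl sumr_ge0.
rewrite -(ler_pM2l c_gt0) mulrDr mulrCA divff ?gt_eqF// mulr1.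
by have := sumK n; have := a_ge0 (n + K)%N; lra.
Qed.

(** Past a [K] where the tail sums of [u] are below 1/2, a product of factors [1 - u n] is at least
    1 minus the sum of the [u n], hence above 1/2. [K] is found before [a], so it serves all
    sequences [a] at once. *)
Lemma summable_persist (R : realType) (u : nat -> R) :
    (forall n, 0 <= u n) -> (exists M, forall n, \sum_(k < n) u k <= M) ->
  exists K, forall a : nat -> R, 0 <= a K ->
    (forall n, (K <= n)%N -> (1 - u n) * a n <= a n.+1) ->
  forall n, (K <= n)%N -> a K / 2 <= a n.
Proof.
move=> u_ge0 [M boundM]; pose S (n : nat) : R := \sum_(k < n) u k.
have SS n : S n.+1 = S n + u n by rewrite /S big_ord_recr.
have supS : has_sup (range S).
  split; first by exists (S 0%N); exists 0%N.
  by exists M => _ [n _ <-]; exact: boundM.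
have [_ [K _ <-] KS] := sup_adherent (divr_gt0 ltr01 (ltr0Sn R 1)) supS.
have tail d : S (d + K)%N < S K + 1 / 2.
  rewrite -ltrBlDr; apply: le_lt_trans KS; rewrite lerD2r.
  by apply: sup_upper_bound => //; exists (d + K)%N.
have mono d : S K <= S (d + K)%N.
  by elim: d => // d IH; rewrite addSn SS (le_trans IH)// lerDl.
exists K => a aK_ge0 aS n Kn; rewrite -(subnK Kn); move: (n - K)%N => {Kn n} d.
suff : a K * (1 - (S (d + K)%N - S K)) <= a (d + K)%N by have := tail d; nra.
elim: d => [|d IH]; first by rewrite subrr subr0 mulr1.
have := tail d.+1; have := mono d; have := u_ge0 (d + K)%N.
rewrite addSn SS => u0 monod taild.
have v_le1 : u (d + K)%N <= 1 by lra.
have := ler_wpM2l (_ : 0 <= 1 - u (d + K)%N) IH; rewrite subr_ge0 => /(_ v_le1).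
move=> h; apply: le_trans (aS _ (leq_addl _ _)); apply: le_trans h.
(* The mixed term that is dropped in [(1 - u) * (1 - v) >= 1 - u - v]. *)
have : 0 <= a K * (u (d + K)%N * (S (d + K)%N - S K)).
  by rewrite !mulr_ge0// subr_ge0.
by lra.
Qed.

(** * The whole process: strong majorization and the first entry of [rho k] *)

Definition first_coef (R : realType) (xi eta : nat -> R) (k : nat) : R :=
  if mseq xi eta k == 1%N then tseq xi eta k else 0.

Lemma first_coef_ge0 (R : realType) (xi eta : nat -> R) k :
  0 <= tseq xi eta k -> 0 <= first_coef xi eta k.
Proof. by rewrite /first_coef; case: ifP. Qed.

Section Process.
Context (R : realType) (xi eta : nat -> R).
Hypotheses (hxi : co_star xi) (heta : co_star eta).
Hypotheses (hmaj : majorized xi eta) (hpos : forall n, 0 < xi n).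
Local Notation rho := (rho xi eta).
Local Notation m := (mseq xi eta).
Local Notation t := (tseq xi eta).
Local Notation u := (first_coef xi eta).
Local Notation gap k := (partial_gap (rho k) (fun j => xi (j + k)%N)).

Lemma co_star_small (x : nat -> R) : co_star x ->
  forall e, 0 < e -> exists n, forall k, (n <= k)%N -> x k < e.
Proof.
move=> [x_ge0 _ /cvgrPdist_lt x0] e /x0[N _ xN]; exists N => k /xN /=.
by rewrite sub0r normrN ger0_norm.
Qed.

Lemma rho_dominates k : dominates (rho k) (fun j => xi (j + k)%N).
Proof.
have [_ xi_mono _] := hxi; elim: k => [|k IH].
  have [eta_ge0 eta_mono _] := heta; split => //=.
  - by move=> e /(co_star_small heta)[n en]; exists n; exact: en.
  - move=> n; rewrite /partial_gap; under eq_bigr do rewrite addn0.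
    by rewrite big_split/= sumrN subr_ge0 hmaj.
have -> : (fun j => xi (j + k.+1)%N) = (fun j => xi (j.+1 + k)%N).
  by apply/funext => j; rewrite addSnnS.
apply: (@dominates_step _ _ (fun j => xi (j + k)%N)) => // n p np.
by apply: xi_mono; rewrite leq_add2r.
Qed.

Lemma rho_ge0 k n : 0 <= rho k n.
Proof. by have [] := rho_dominates k. Qed.

Lemma rho_mono k n p : (n <= p)%N -> rho k p <= rho k n.
Proof. by have [_ + _ _] := rho_dominates k; apply. Qed.

Lemma gap_ge0 k n : 0 <= gap k n.
Proof. by have [_ _ _ +] := rho_dominates k; apply. Qed.

Lemma mseqP k : (0 < m k)%N /\ rho k (m k) < xi k <= rho k (m k).-1.
Proof.
exact: (@dominates_step_index _ _ (fun j => xi (j + k)%N) _ (rho_dominates k)).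
Qed.

Lemma tseqP k :
  0 < t k <= 1 /\ xi k = t k * rho k (m k).-1 + (1 - t k) * rho k (m k).
Proof.
exact: (@dominates_step_coef _ _ (fun j => xi (j + k)%N) _ (rho_dominates k)).
Qed.

Let u_ge0 k : 0 <= u k.
Proof. by apply: first_coef_ge0; have [/andP[/ltW]] := tseqP k. Qed.

Lemma rho_lt k j : (j < (m k).-1)%N -> rho k.+1 j = rho k j.
Proof. exact: (@step_seq_lt _ (rho k) (fun j => xi (j + k)%N)). Qed.

Lemma rho_eq k :
  rho k.+1 (m k).-1 = (1 - t k) * rho k (m k).-1 + t k * rho k (m k).
Proof. exact: (@step_seq_eq _ (rho k) (fun j => xi (j + k)%N)). Qed.

Lemma gapS_ge k n : (m k <= n)%N -> gap k.+1 n = gap k n.+1.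
Proof.
move=> mn; rewrite -(@partial_gap_step _ _ (fun j => xi (j + k)%N) _
  (rho_dominates k))//.
by apply: eq_bigr => j _; rewrite addSnnS.
Qed.

Lemma gapS_le k n : gap k.+1 n <= gap k n.+1.
Proof.
apply: le_trans (@partial_gap_step_le _ _ (fun j => xi (j + k)%N) _
  (rho_dominates k) n) => //.
by rewrite le_eqVlt; apply/orP; left; apply/eqP/eq_bigr => j _; rewrite addSnnS.
Qed.

Lemma gap_le0 k n : gap k n <= gap 0%N (n + k)%N.
Proof.
elim: k n => [|k IH] n; first by rewrite addn0.
by rewrite addnS (le_trans (gapS_le _ _))//; apply: IH.
Qed.

(** Step [k] leaves the entries before index [(m k).-1] alone, and these are at least
    [xi k >= xi k.+1]; the entry of index [m k.+1], being below [xi k.+1], is not among them. *)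
Lemma mseq_shift k : (m k <= (m k.+1).+1)%N.
Proof.
have [_ /andP[_ xi_le]] := mseqP k; have [_ /andP[xiS_gt _]] := mseqP k.+1.
rewrite leqNgt; apply/negP => mm; move: xiS_gt; rewrite ltNge => /negP; apply.
rewrite rho_lt; last by lia.
have [_ xi_mono _] := hxi; apply: (le_trans (xi_mono k k.+1 _)) => //.
by apply: (le_trans xi_le); apply: rho_mono; lia.
Qed.

Lemma mseq_shift_le i k : (i <= k)%N -> (i + m i <= k + m k)%N.
Proof.
move=> ik; rewrite -(subnK ik); elim: (k - i)%N => // d IH.
by apply: (leq_trans IH); have := mseq_shift (d + i)%N; rewrite addSn; lia.
Qed.

(** For [i <= k] one has [i + m i <= k + m k = k.+1], so the equality case [gapS_ge] applies at
    every step up to [k]. *)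
Lemma gap0_first_step k : m k = 1%N -> gap 0%N k.+2 = rho k.+1 0%N - xi k.+1.
Proof.
move=> mk; transitivity (gap k.+1 1%N); last by rewrite /partial_gap big_ord1.
suff gapE i : (i <= k.+1)%N -> gap 0%N k.+2 = gap i (k.+2 - i)%N.
  by rewrite (gapE k.+1)// subSnn.
elim: i => [|i IH] ik; first by rewrite subn0.
rewrite IH ?(ltnW ik)// (_ : (k.+2 - i)%N = (k.+2 - i.+1).+1); last by lia.
by rewrite gapS_ge//; have := @mseq_shift_le i k ik; rewrite mk; lia.
Qed.

Lemma rho_first k :
  rho k.+1 0%N = (1 - u k) * rho k 0%N + u k * rho k 1%N.
Proof.
have [m_gt0 _] := mseqP k; rewrite /first_coef; case: ifPn => [/eqP mk|mk1].
  by have := rho_eq k; rewrite mk.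
by rewrite rho_lt ?subr0 ?mul1r ?mul0r ?addr0//; lia.
Qed.

Lemma rho_first_noninc k : rho k.+1 0%N <= rho k 0%N.
Proof.
rewrite rho_first.
have := u_ge0 k; have := rho_mono k (leqnSn 0); nra.
Qed.

Lemma rho_first_gt0 k : 0 < rho k 0%N.
Proof.
have := gap_ge0 k 1; rewrite /partial_gap big_ord1 subr_ge0.
exact: lt_le_trans.
Qed.

Lemma rho_first_anti n p : (n <= p)%N -> rho p 0%N <= rho n 0%N.
Proof.
move=> np; rewrite -(subnK np); elim: (p - n)%N => // d IH.
by rewrite addSn (le_trans (rho_first_noninc _)).
Qed.

Lemma strongly_majorized_rhoP : strongly_majorized xi eta <->
  (forall e, 0 < e -> exists n, rho n 0%N < e).
Proof.
have gap0E n : gap 0%N n = \sum_(j < n) (eta j - xi j).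
  by apply: eq_bigr => j _; rewrite addn0.
have -> : strongly_majorized xi eta <->
    (forall e, 0 < e -> forall N, exists2 n, (N <= n)%N & gap 0%N n < e).
  rewrite -limn_einf0P; last by move=> n; exact: gap_ge0.
  under eq_fun do rewrite gap0E.
  by split=> [[]|].
split=> [small e e_gt0|small e e_gt0 N].
  (* [rho n 0] is [gap n 1 + xi n], and [gap n 1] is at most the initial gap of [n.+1] terms: each
     summand gets half of [e]. *)
  have e2_gt0 : 0 < e / 2 by rewrite divr_gt0.
  have [N xi_lt] := co_star_small hxi e2_gt0.
  have [[|n] //] := small _ e2_gt0 N.+1; rewrite ltnS => Nn gap_lt.
  exists n; have := gap_le0 n 1; rewrite /partial_gap big_ord1 => gap_le.
  by have := xi_lt n Nn; have := le_lt_trans gap_le gap_lt; rewrite add0n; lra.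
have [K0 K0_lt] := small e e_gt0; pose K := maxn K0 N.
have K_lt : rho K 0%N < e.
  by apply: le_lt_trans K0_lt; apply: rho_first_anti; rewrite leq_maxl.
suff [k Kk mk] : exists2 k, (K <= k)%N & m k = 1%N.
  exists k.+2; first by rewrite !leqW// (leq_trans _ Kk)// leq_maxr.
  rewrite gap0_first_step//; have := hpos k.+1.
  by have := @rho_first_anti K k.+1 (leqW Kk); lra.
(* Without a later step with [m k = 1], the first entry would stay at its positive value
   [rho K 0]. *)
apply: contrapT => no; have [n] := small _ (rho_first_gt0 K).
rewrite ltNge => /negP; apply.
apply: (@le_trans _ _ (rho (n + K)%N 0%N)); last first.
  by apply: rho_first_anti; rewrite leq_addr.
elim: n => // d IH; rewrite (le_trans IH)// addSn rho_first /first_coef ifF.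
  by rewrite subr0 mul1r mul0r addr0.
by apply/negP => /eqP mk; apply: no; exists (d + K)%N => //; rewrite leq_addl.
Qed.

Lemma rho_first_small_divergent :
  (forall e, 0 < e -> exists n, rho n 0%N < e) <->
  (forall M, exists n, M < \sum_(k < n) u k).
Proof.
split=> [small M|unb]; last first.
  apply: (decay_to0 _ rho_first_noninc u_ge0 unb) => [n|L L_gt0 L_le].
    exact: rho_ge0.
  have L2 : 0 < L / 2 by rewrite divr_gt0.
  (* When [m n = 1] the second entry is below [xi n < L / 2], so it lies at least [L / 2] under the
     first, and the drop is [u n] times this distance. *)
  exists (L / 2) => //; have [K xi_lt] := co_star_small hxi L2.
  exists K => n Kn; rewrite rho_first; have := u_ge0 n.
  rewrite /first_coef; case: ifPn => [/eqP mn t0|_ _]; last by lra.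
  have [_ /andP[+ _]] := mseqP n; rewrite mn => r_lt.
  by have := xi_lt n Kn; have := L_le n; nra.
(* With bounded sums of [u] the first entry stays above half of its positive value at [K], since
   each step keeps at least the fraction [1 - u p] of it. *)
apply: contrapT => /forallNP bd.
have [|K persist] := summable_persist u_ge0.
  by exists M => n; rewrite leNgt; apply/negP/bd.
have [|n n_lt] := small (rho K 0%N / 2).
  by rewrite divr_gt0// rho_first_gt0.
have : rho (n + K)%N 0%N < rho K 0%N / 2.
  by apply: le_lt_trans n_lt; apply: rho_first_anti; rewrite leq_addr.
rewrite ltNge => /negP; apply.
apply: (persist (fun n => rho n 0%N)) (leq_addl _ _) => [|p _].
  exact: rho_ge0.
by rewrite rho_first lerDl mulr_ge0 ?rho_ge0// u_ge0.
Qed.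

End Process.

(** * Rows of the factors and of [Wfin] *)

Lemma cvg_series_delta (R : realType) (p : nat) (f : nat -> R) :
  series (fun k => (k == p)%:R * f k) @ \oo --> f p.
Proof.
apply: cvg_near_cst; exists p.+1 => // n /= pn.
rewrite /series/= (eq_bigr (fun k => if k == p then f k else 0)); last first.
  by move=> k _; case: eqP; rewrite ?mul1r ?mul0r.
by rewrite -big_mkcond big_nat1_eq pn.
Qed.

Lemma cvg_series_lin (R : realType) (f g : nat -> R) (a b lf lg : R) :
    series f @ \oo --> lf -> series g @ \oo --> lg ->
  series (fun k => a * f k + b * g k) @ \oo --> a * lf + b * lg.
Proof.
move=> cf cg.
have -> : series (fun k => a * f k + b * g k) =
    (fun n => a * series f n + b * series g n).
  by apply/funext => n; rewrite /series/= big_split/= !mulr_sumr.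
by apply: cvgD; apply: cvgMl_tmp.
Qed.

(* Every row of I_n (+) V(m, t) (+) I_oo has at most two nonzero entries: the
   coefficients [row_coef1], in column [row_col], and [row_coef2], in column
   n + m. *)
Section Rows.
Context (R : realType) (n m : nat) (t : R).

Definition row_coef1 (i : nat) : R :=
  if i == n then Num.sqrt t else if i == (n + m)%N then Num.sqrt (1 - t) else 1.

Definition row_coef2 (i : nat) : R :=
  if i == n then - Num.sqrt (1 - t)
  else if i == (n + m)%N then Num.sqrt t else 0.

Definition row_col (i : nat) : nat :=
  if i == n then (n + m.-1)%N else if (n < i <= n + m)%N then i.-1 else i.

Hypothesis m_gt0 : (0 < m)%N.

Lemma infmx_embed_row i k : infmx_embed n (Vmx m t) i k =
  row_coef1 i * (k == row_col i)%:R + row_coef2 i * (k == n + m)%N%:R.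
Proof.
rewrite /infmx_embed /row_coef1 /row_coef2 /row_col.
have natE (b b' : bool) : b = b' -> b%:R = b'%:R :> R by move->.
case: ifPn => [/andP[/andP[ni inm] /andP[nk knm]]|out]; last first.
  have [ein|ni] := eqVneq i n.
    have -> : (i == k) = false by apply/negbTE; lia.
    have -> : (k == n + m)%N = false by apply/negbTE; lia.
    have -> : (k == n + m.-1)%N = false by apply/negbTE; lia.
    by rewrite !mulr0 addr0.
  have [einm|nim] := eqVneq i (n + m)%N.
    rewrite ifT; last by lia.
    have -> : (i == k) = false by apply/negbTE; lia.
    have -> : (k == n + m)%N = false by apply/negbTE; lia.
    have -> : (k == i.-1)%N = false by apply/negbTE; lia.
    by rewrite !mulr0 addr0.
  rewrite mul0r addr0 mul1r; apply: natE; case: ifPn => ?; lia.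
rewrite mxE !inordK; try by rewrite ltnS leq_subLR.
have -> : (i - n == 0)%N = (i == n) by lia.
have -> : (i - n == m)%N = (i == n + m)%N by lia.
have -> : (k - n == m)%N = (k == n + m)%N by lia.
have -> : (k - n == m.-1)%N = (k == n + m.-1)%N by lia.
have [ein|ni'] := eqVneq i n.
  have [->|_] := eqVneq k (n + m.-1)%N; last first.
    by case: eqVneq => _; rewrite ?(mulr0, mulr1) add0r.
  by rewrite (_ : (_ == _) = false) ?mulr0 ?addr0 ?mulr1//; lia.
rewrite (_ : (n < i <= n + m)%N); last by lia.
have [einm|nim] := eqVneq i (n + m)%N.
  rewrite (_ : i.-1 = (n + m.-1)%N); last by lia.
  have [->|_] := eqVneq k (n + m.-1)%N; last first.
    by case: eqVneq => _; rewrite ?(mulr0, mulr1) add0r.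
  by rewrite (_ : (_ == _) = false) ?mulr0 ?addr0 ?mulr1//; lia.
by rewrite mul1r mul0r addr0; apply: natE; lia.
Qed.

(** The defining series has at most two nonzero terms, so [limn] is a genuine limit here. *)
Lemma infmx_mul_embed (B : infmx R) i j :
  infmx_mul (infmx_embed n (Vmx m t)) B i j =
  row_coef1 i * B (row_col i) j + row_coef2 i * B (n + m)%N j.
Proof.
rewrite /infmx_mul; apply: (cvg_lim (@Rhausdorff R)).
under eq_fun do rewrite infmx_embed_row mulrDl -!mulrA.
by apply: cvg_series_lin; apply: cvg_series_delta.
Qed.

(** Orthonormality of the rows of the embedded [Vmx m t], expanded bilinearly into the shape that
    the limit takes in [Wfin_rows_orthonormal]. *)
Lemma row_coef_gram i i' : 0 <= t <= 1 ->
  row_coef1 i * (row_coef1 i' * (row_col i == row_col i')%:R +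
                 row_coef2 i' * (row_col i == n + m)%N%:R) +
  row_coef2 i * (row_coef1 i' * (row_col i' == n + m)%N%:R + row_coef2 i') =
  (i == i')%:R.
Proof.
move=> /andP[t_ge0 t_le1].
have st : Num.sqrt t ^+ 2 = t by rewrite sqr_sqrtr.
have st' : Num.sqrt (1 - t) ^+ 2 = 1 - t by rewrite sqr_sqrtr// subr_ge0.
have col_new : row_col n = (n + m.-1)%N by rewrite /row_col eqxx.
have col_end : row_col (n + m) = (n + m.-1)%N.
  by rewrite /row_col; do 2?[case: ifPn => ?]; lia.
have ends : (n + m.-1 == n + m)%N = false by apply/negbTE; lia.
have endn : (n + m == n)%N = false by apply/negbTE; lia.
have col_neq x : x != n -> x != (n + m)%N ->
    ((row_col x == n + m.-1)%N = false) * ((row_col x == n + m)%N = false).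
  by move=> xn xnm; split; apply/negbTE; rewrite /row_col (negbTE xn);
    case: ifPn => ?; lia.
have col_inj x y : x != n -> x != (n + m)%N -> y != n -> y != (n + m)%N ->
    (row_col x == row_col y) = (x == y).
  move=> xn xnm yn ynm; rewrite /row_col (negbTE xn) (negbTE yn).
  by do 2!case: ifPn => ?; lia.
rewrite /row_coef1 /row_coef2; move: st st'.
move: (Num.sqrt t) (Num.sqrt (1 - t)) => a b a2 b2.
(* Nine cases: [i] and [i'] are each [n], [n + m] or another row; on the other rows [row_col] is
   injective and avoids the columns [n + m.-1] and [n + m]. *)
have [->|xn] := eqVneq i n; last have [->|xnm] := eqVneq i (n + m)%N;
  (have [->|yn] := eqVneq i' n; last have [->|ynm] := eqVneq i' (n + m)%N);
  rewrite ?(col_new, col_end, eqxx, ends, endn) ?(eq_sym _ (row_col i'));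
  rewrite ?col_neq//= ?(eq_sym _ i') ?col_inj//;
  rewrite ?(negbTE xn) ?(negbTE xnm) ?(negbTE yn) ?(negbTE ynm);
  rewrite ?(mulr0, mul0r, mulr1, mul1r, addr0, add0r).
all: by [|ring|lra|nra].
Qed.

End Rows.

(** Each row of [Wfin n.+1] combines two rows of [Wfin n], so convergence and value both pass
    through the induction by linearity. *)
Lemma Wfin_rows_orthonormal (R : realType) (xi eta : nat -> R) n i i' :
    (forall k, (0 < mseq xi eta k)%N) ->
    (forall k, 0 <= tseq xi eta k <= 1) ->
  series (fun j => Wfin xi eta n i j * Wfin xi eta n i' j) @ \oo -->
    ((i == i')%:R : R).
Proof.
move=> m_gt0 t01; elim: n i i' => [|n IH] i i'.
  rewrite /= /infmx1.
  under eq_fun do rewrite (eq_sym i).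
  by rewrite (eq_sym i); apply: (@cvg_series_delta _ i (fun j => (i' == j)%:R)).
rewrite -(row_coef_gram n (m_gt0 n) i i' (t01 n)).
have -> : (fun j => Wfin xi eta n.+1 i j * Wfin xi eta n.+1 i' j) = (fun j =>
    row_coef1 n (mseq xi eta n) (tseq xi eta n) i *
     (row_coef1 n (mseq xi eta n) (tseq xi eta n) i' *
      (Wfin xi eta n (row_col n (mseq xi eta n) i) j *
       Wfin xi eta n (row_col n (mseq xi eta n) i') j) +
      row_coef2 n (mseq xi eta n) (tseq xi eta n) i' *
      (Wfin xi eta n (row_col n (mseq xi eta n) i) j *
       Wfin xi eta n (n + mseq xi eta n)%N j)) +
    row_coef2 n (mseq xi eta n) (tseq xi eta n) i *
     (row_coef1 n (mseq xi eta n) (tseq xi eta n) i' *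
      (Wfin xi eta n (row_col n (mseq xi eta n) i') j *
       Wfin xi eta n (n + mseq xi eta n)%N j) +
      row_coef2 n (mseq xi eta n) (tseq xi eta n) i' *
      (Wfin xi eta n (n + mseq xi eta n)%N j *
       Wfin xi eta n (n + mseq xi eta n)%N j))).
  by apply/funext => j; rewrite /= !infmx_mul_embed//; ring.
(* The inserted 1 is the limit of the squared norm of row [n + m n]. *)
rewrite -[X in _ + _ * (_ + X)]mulr1.
have IHm := IH (n + mseq xi eta n)%N (n + mseq xi eta n)%N; rewrite eqxx in IHm.
by do 3?apply: cvg_series_lin; first [exact: IHm | exact: IH].
Qed.

(** * Columns of [W] *)

(* By induction, in each column the rows of index >= n of W^{(n)} have a single
   nonzero entry: [tail_coef n j], in the row of index n + [tail_pos n j]. *)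
Section Tail.
Context (R : realType) (xi eta : nat -> R).
Local Notation m := (mseq xi eta).
Local Notation t := (tseq xi eta).
Local Notation W := (Wmx xi eta).

Fixpoint tail_pos (n j : nat) : nat :=
  if n is n'.+1 then
    let p := tail_pos n' j in if (p < m n')%N then p else p.-1
  else j.

(** In column [p] of [V(m, t)], extended by the identity, [head_factor] is the top entry and
    [tail_factor] the only nonzero entry below it. *)
Definition tail_factor (n p : nat) : R :=
  if p == (m n).-1 then Num.sqrt (1 - t n)
  else if p == m n then Num.sqrt (t n) else 1.

Fixpoint tail_coef (n j : nat) : R :=
  if n is n'.+1 then tail_coef n' j * tail_factor n' (tail_pos n' j) else 1.

Definition head_factor (n p : nat) : R :=
  if p == (m n).-1 then Num.sqrt (t n)
  else if p == m n then - Num.sqrt (1 - t n) else 0.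

Hypothesis m_gt0 : forall k, (0 < m k)%N.
Hypothesis t01 : forall k, 0 <= t k <= 1.

(** Below its top row, column [p] of the extended [V(m, t)] has its entry in row [p.+1] if [p < m],
    and in row [p] otherwise; counted from row [n.+1] instead of [n], these become [p] and
    [p.-1]. *)
Lemma Wfin_tail n p j :
  Wfin xi eta n (n + p)%N j = (p == tail_pos n j)%:R * tail_coef n j.
Proof.
elim: n p => [|n IH] p; first by rewrite add0n mulr1.
rewrite /= infmx_mul_embed// IH /row_coef1 /row_coef2 /row_col /tail_factor.
have mn := m_gt0 n.
have -> : (n.+1 + p == n)%N = false by apply/negbTE; lia.
have -> : (n.+1 + p == n + m n)%N = (p == (m n).-1) by lia.
have -> : (n < n.+1 + p <= n + m n)%N = (p < m n)%N by lia.
move: (tail_pos n j) (tail_coef n j) (IH p) (IH p.+1) => q c.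
rewrite -addSnnS => IHp IHpS.
have [pm|pm] := ltnP p (m n); last first.
  have -> : (p == (m n).-1) = false by apply/negbTE; lia.
  rewrite mul0r addr0 mul1r IHpS.
  have -> : (p.+1 == q) = (p == if (q < m n)%N then q else q.-1).
    by case: ifPn; lia.
  case: eqP => [pq|_]; last by rewrite !mul0r.
  by rewrite !ifN ?mulr1//; move: pq; case: ifPn; lia.
rewrite addSn/= IHp; have [->|pm1] := eqVneq p (m n).-1.
  have [qm1|qm1] := eqVneq q (m n).-1.
    rewrite ifT; last by rewrite qm1; lia.
    rewrite qm1 eqxx (_ : (m n == _) = false); last by apply/negbTE; lia.
    by rewrite /=; ring.
  have [qm|qm] := eqVneq q (m n).
    by rewrite qm ltnn eqxx /=; ring.
  rewrite (_ : (_ == if _ then _ else _) = false) /=; first by ring.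
  by apply/negbTE; case: ifPn; lia.
rewrite mul0r addr0 mul1r.
have -> : (p == if (q < m n)%N then q else q.-1) = (p == q) by case: ifPn; lia.
case: eqP => [<-|_]; last by rewrite !mul0r.
by rewrite (negbTE pm1) ifN ?mulr1//; lia.
Qed.

Lemma Wmx_tail n j : W n j = tail_coef n j * head_factor n (tail_pos n j).
Proof.
rewrite /Wmx /= infmx_mul_embed// /row_coef1 /row_coef2 /row_col eqxx.
rewrite !Wfin_tail.
rewrite /head_factor; move: (tail_pos n j) => q; have mn := m_gt0 n.
have [qm1|qm1] := eqVneq q (m n).-1.
  rewrite qm1 (_ : (m n == _) = false); last by apply/negbTE; lia.
  by rewrite /=; ring.
by case: eqVneq => _ /=; ring.
Qed.

(** The factor of a later step acts as the identity on row [i]. *)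
Lemma Wmx_stable n i j : (i < n)%N -> Wfin xi eta n i j = W i j.
Proof.
move=> i_n; rewrite -(subnK i_n); elim: (n - i.+1)%N => // d IH.
rewrite addSn -IH [LHS]infmx_mul_embed// /row_coef1 /row_coef2 /row_col.
have -> : (i == d + i.+1)%N = false by apply/negbTE; lia.
have -> : (i == d + i.+1 + m (d + i.+1))%N = false by apply/negbTE; lia.
by rewrite ifF ?mul1r ?mul0r ?addr0//; apply/negbTE; lia.
Qed.

(** Columns [p] and [p'] of the extended [V(m, t)] are orthonormal; apart from the top row, their
    product survives only if both tail entries land in the same row. *)
Lemma tail_step_gram n p p' : let next q := if (q < m n)%N then q else q.-1 in
  head_factor n p * head_factor n p' = (p == p')%:R -
    (next p == next p')%:R * (tail_factor n p * tail_factor n p').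
Proof.
move=> next; have mn := m_gt0 n; have [t_ge0 t_le1] := andP (t01 n).
have st : Num.sqrt (t n) ^+ 2 = t n by rewrite sqr_sqrtr.
have st' : Num.sqrt (1 - t n) ^+ 2 = 1 - t n by rewrite sqr_sqrtr// subr_ge0.
have nextE q : (next q == (m n).-1) = (q == (m n).-1) || (q == m n).
  by rewrite /next; case: ifPn; lia.
have next_m1 : next (m n).-1 = (m n).-1 by apply/eqP; rewrite nextE eqxx.
have next_m : next (m n) = (m n).-1 by apply/eqP; rewrite nextE eqxx orbT.
have next_inj q q' : q != (m n).-1 -> q != m n -> q' != (m n).-1 -> q' != m n ->
    (next q == next q') = (q == q').
  by rewrite /next; do 2!case: ifPn; lia.
have mm1 : (m n == (m n).-1) = false by apply/negbTE; lia.
rewrite /head_factor /tail_factor.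
move: (Num.sqrt (t n)) (Num.sqrt (1 - t n)) st st' => a b a2 b2.
have [->|p_m1] := eqVneq p (m n).-1; last have [->|p_m] := eqVneq p (m n);
  (have [->|p'_m1] := eqVneq p' (m n).-1;
   last have [->|p'_m] := eqVneq p' (m n));
  rewrite ?(next_m1, next_m, eqxx, mm1) ?(eq_sym _ (next p')) ?(eq_sym _ p')
    ?next_inj ?nextE ?(negbTE p_m1) ?(negbTE p_m) ?(negbTE p'_m1) ?(negbTE p'_m)
    ?mm1 ?(eq_sym _ (m n)) ?mm1 //=.
all: by [ring | nra].
Qed.

(** The subtracted term is the share of the rows from [n] on in the Gram matrix of the columns of
    [Wfin n]; adding row [n] turns it into the share of the rows from [n.+1] on. *)
Lemma Wmx_cols_gram n j j' : \sum_(i < n) W i j * W i j' = (j == j')%:R -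
  (tail_pos n j == tail_pos n j')%:R * (tail_coef n j * tail_coef n j').
Proof.
elim: n => [|n IH]; first by rewrite big_ord0 /= !mulr1 subrr.
rewrite big_ord_recr/= IH !Wmx_tail mulrACA tail_step_gram /=.
ring.
Qed.

End Tail.

(** * Norms of the columns and orthostochasticity *)

Section Orthostochastic.
Context (R : realType) (xi eta : nat -> R).
Local Notation m := (mseq xi eta).
Local Notation t := (tseq xi eta).
Local Notation u := (first_coef xi eta).
Local Notation W := (Wmx xi eta).
Local Notation pos := (tail_pos xi eta).
Local Notation coef := (tail_coef xi eta).
Hypothesis m_gt0 : forall k, (0 < m k)%N.
Hypothesis t01 : forall k, 0 <= t k <= 1.

Let u_ge0 k : 0 <= u k.
Proof. by apply: first_coef_ge0; case/andP: (t01 k). Qed.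

Lemma tail_factor_ge0_le1 n p : 0 <= tail_factor xi eta n p <= 1.
Proof.
have [t_ge0 t_le1] := andP (t01 n); rewrite /tail_factor.
case: ifP => _; last case: ifP => _; rewrite ?sqrtr_ge0 ?ler01 ?lexx//=.
  by rewrite -[leRHS]sqrtr1 ler_wsqrtr// gerBl.
by rewrite -[leRHS]sqrtr1 ler_wsqrtr.
Qed.

Lemma tail_coef_ge0 n j : 0 <= coef n j.
Proof.
elim: n => [|n IH] //=; apply: mulr_ge0 => //.
by case/andP: (tail_factor_ge0_le1 n (pos n j)).
Qed.

Lemma tail_coef_noninc n j : coef n.+1 j <= coef n j.
Proof.
rewrite /= ler_piMr ?tail_coef_ge0//.
by case/andP: (tail_factor_ge0_le1 n (pos n j)).
Qed.

Lemma tail_coef_anti n k j : (n <= k)%N -> coef k j <= coef n j.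
Proof.
move=> nk; rewrite -(subnK nk); elim: (k - n)%N => // d IH.
by rewrite addSn (le_trans (tail_coef_noninc _ _)).
Qed.

(** Position 0 is [(m n).-1] exactly when [m n = 1], and it is never [m n]. *)
Lemma tail_coef_first n j : pos n j = 0%N ->
  coef n.+1 j ^+ 2 = (1 - u n) * coef n j ^+ 2.
Proof.
have mn := m_gt0 n; have [t_ge0 t_le1] := andP (t01 n).
move=> /= ->; rewrite /tail_factor /first_coef exprMn mulrC; congr (_ * _).
rewrite (_ : (0 == (m n).-1)%N = (m n == 1%N)); last by lia.
case: ifP => _; first by rewrite sqr_sqrtr// subr_ge0.
by rewrite (_ : (0 == m n)%N = false) ?expr1n ?subr0//; apply/negbTE; lia.
Qed.

Lemma tail_pos_le n k j : (n <= k)%N -> (pos k j <= pos n j)%N.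
Proof.
move=> nk; rewrite -(subnK nk); elim: (k - n)%N => // d IH.
by rewrite addSn /=; case: ifP => _ //; apply: leq_trans IH; exact: leq_pred.
Qed.

Lemma tail_pos0 n k j : (n <= k)%N -> pos n j = 0%N -> pos k j = 0%N.
Proof. by move=> /(tail_pos_le j) + pn; rewrite pn leqn0 => /eqP. Qed.

Lemma first_coef_unbounded_infinite :
    (forall M, exists n, M < \sum_(k < n) u k) ->
  forall N, exists2 k, (N <= k)%N & m k = 1%N.
Proof.
move=> unb N; apply: contrapT => no.
have [n] := unb (\sum_(k < N) u k).
rewrite ltNge => /negP; apply.
apply: (@le_trans _ _ (\sum_(k < n + N) u k)).
  by rewrite big_split_ord/= lerDl sumr_ge0.
elim: n => // d IH; rewrite addSn big_ord_recr/=.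
rewrite {2}/first_coef ifF ?addr0//; apply/negP => /eqP mk.
by apply: no; exists (d + N)%N => //; rewrite leq_addl.
Qed.

Lemma tail_pos_eventually0 j : (forall M, exists n, M < \sum_(k < n) u k) ->
  exists K, pos K j = 0%N.
Proof.
move=> /first_coef_unbounded_infinite inf1.
(* Induction on a bound for the position, with the starting step generalized: each step with
   [m k = 1] lowers a positive position. *)
have [N] := ubnP (pos 0 j); elim: N {1}0%N => [|N IH] n; first by rewrite ltn0.
rewrite ltnS => posN.
have [k nk mk] := inf1 n.
have [pk0|pk0] := eqVneq (pos k.+1 j) 0%N; first by exists k.+1.
apply: (IH k.+1); apply: leq_trans posN.
apply: leq_trans (tail_pos_le j nk); move: pk0; rewrite /= mk; case: ifP; lia.
Qed.

Lemma tail_coef_small_divergent :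
  (forall j e, 0 < e -> exists n, coef n j ^+ 2 < e) <->
  (forall M, exists n, M < \sum_(k < n) u k).
Proof.
split=> [small M|unb j]; last first.
  have [K pK] := tail_pos_eventually0 j unb.
  apply: (@decay_to0 _ (fun n => coef n j ^+ 2) u) => //.
  - by move=> n; rewrite sqr_ge0.
  - by move=> n; rewrite ler_sqr ?nnegrE ?tail_coef_ge0 ?tail_coef_noninc.
  - move=> L L_gt0 L_le; exists L => //; exists K => n Kn.
    rewrite tail_coef_first ?(tail_pos0 Kn)//.
    by have := L_le n; have := u_ge0 n; nra.
apply: contrapT => /forallNP bd.
have [|K persist] := summable_persist u_ge0.
  by exists M => n; rewrite leNgt; apply/negP/bd.
(* Row [K] of [Wfin K] has norm 1, and its nonzero entries are the coefficients of the columns at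
   position 0. The column depends on [K], which was fixed first. *)
have [j [pK cK]] : exists j, pos K j = 0%N /\ 0 < coef K j.
  apply: contrapT => /forallNP no.
  have rowK0 i : Wfin xi eta K K i = 0.
    rewrite -[X in Wfin _ _ _ X]addn0 (Wfin_tail m_gt0).
    have [pK|_] := eqVneq 0%N (pos K i); last by rewrite mul0r.
    have := no i; rewrite -pK lt_neqAle tail_coef_ge0 andbT eq_sym.
    by move=> /not_andP[//|/negP/negPn/eqP->]; rewrite mulr0.
  have := @Wfin_rows_orthonormal _ xi eta K K K m_gt0 t01; rewrite eqxx.
  have -> : series (fun i => Wfin xi eta K K i * Wfin xi eta K K i) = fun=> 0.
    by apply/funext => n; rewrite /series/= big1// => i _; rewrite rowK0 mul0r.
  move=> /(cvg_lim (@Rhausdorff R)); rewrite (lim_cst (@Rhausdorff R)) => /eqP.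
  by rewrite eq_sym oner_eq0.
have cK2 : 0 < coef K j ^+ 2 by rewrite exprn_gt0.
have [|n] := small j (coef K j ^+ 2 / 2); first by rewrite divr_gt0.
have : coef (n + K) j ^+ 2 <= coef n j ^+ 2.
  by rewrite ler_sqr ?nnegrE ?tail_coef_ge0 ?tail_coef_anti// leq_addr.
move=> /le_lt_trans h /h; rewrite ltNge => /negP; apply.
apply: (persist (fun n => coef n j ^+ 2)) (leq_addl _ _) => [|p Kp].
  exact: ltW.
by rewrite tail_coef_first// (tail_pos0 Kp).
Qed.

Lemma orthostochastic_tail_coef : orthostochastic (Qmx xi eta) <->
  (forall j e, 0 < e -> exists n, coef n j ^+ 2 < e).
Proof.
split=> [[U [[_ UTU] QU]] j e e_gt0|small].
  have /cvgrPdist_lt/(_ e e_gt0)[N _ /(_ N)] := UTU j j.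
  rewrite /= leqnn => /(_ isT) dist; exists N; move: dist.
  (* The squares of the entries of [U] and [W] agree, so their partial column norms do too; those of
     [U] tend to 1. *)
  have -> : series (fun k => infmx_tr U j k * U k j) N = 1 - coef N j ^+ 2.
    have := Wmx_cols_gram m_gt0 t01 N j j; rewrite !eqxx mul1r -expr2 => <-.
    rewrite /series/= big_mkord; apply: eq_bigr => k _.
    by rewrite /infmx_tr -!expr2 -QU.
  by rewrite /infmx1 eqxx opprB addrC subrK ger0_norm// sqr_ge0.
exists W; split; last by [].
split=> i j; rewrite /infmx1 /infmx_tr.
  (* After [(maxn i j).+1] steps both rows have reached their final form. *)
  have := @Wfin_rows_orthonormal _ xi eta (maxn i j).+1 i j m_gt0 t01.
  suff -> : (fun k => Wfin xi eta (maxn i j).+1 i k *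
      Wfin xi eta (maxn i j).+1 j k) = (fun k => W i k * W j k) by [].
  apply/funext => k; rewrite !(Wmx_stable m_gt0)//.
    by rewrite ltnS leq_maxr.
  by rewrite ltnS leq_maxl.
apply/cvgrPdist_lt => e e_gt0.
(* Smallness concerns squares, hence [e ^+ 2]; the error [coef n i * coef n j] is then below [e], as
   [coef n j <= 1]. *)
have [|N cN] := small i (e ^+ 2); first by rewrite exprn_gt0.
exists N => // n /= Nn.
rewrite /series/= big_mkord (Wmx_cols_gram m_gt0 t01) opprB addrC subrK.
have ci_lt : coef n i < e.
  apply: (le_lt_trans (tail_coef_anti i Nn)).
  by move: cN; rewrite ltr_sqr ?nnegrE ?tail_coef_ge0 ?ltW.
have cj_le : coef n j <= 1 by apply: (@tail_coef_anti 0).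
have ci0 := tail_coef_ge0 n i; have cj0 := tail_coef_ge0 n j.
by case: eqP => _; rewrite ?mul0r ?normr0// mul1r ger0_norm ?mulr_ge0//; nra.
Qed.

End Orthostochastic.

Theorem theorem4p7 (R : realType) (xi eta : nat -> R)
    (hxi : co_star xi) (heta : co_star eta)
    (hmaj : majorized xi eta) (hpos : forall n, 0 < xi n) :
  (strongly_majorized xi eta <->
   (\sum_(0 <= k <oo | mseq xi eta k == 1%N) (tseq xi eta k)%:E = +oo)%E) /\
  ((\sum_(0 <= k <oo | mseq xi eta k == 1%N) (tseq xi eta k)%:E = +oo)%E <->
   orthostochastic (Qmx xi eta)).
Proof.
have m_gt0 k : (0 < mseq xi eta k)%N by have [] := mseqP hxi heta hmaj hpos k.
have t01 k : 0 <= tseq xi eta k <= 1.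
  by have [/andP[/ltW -> ->]] := tseqP hxi heta hmaj hpos k.
rewrite nneseries_pinftyP => [|k _]; last by case/andP: (t01 k).
split.
  by rewrite strongly_majorized_rhoP// rho_first_small_divergent.
by rewrite orthostochastic_tail_coef// tail_coef_small_divergent.
Qed.
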